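(* For all positive integers $m_1, m_2$ there is an $M$ such that every good abstract rotation system on $M$ elements contains $\mathcal{C}_{m_1}$ or $\mathcal{T}_{m_2}$.
   Context: An abstract rotation system on a set $V=\{v_1,\dots,v_n\}$ is an $n$-tuple $(\pi_{v_1},\dots,\pi_{v_n})$ where $\pi_{v_i}$ is a cyclic permutation of $V\setminus\{v_i\}$ (the rotation at $v_i$). For $W\subseteq V$, the induced subsystem on $W$ consists of the restrictions of $\pi_w$ ($w\in W$) to $W\setminus\{w\}$. A system on a 4-element set, linearly ordered, satisfies the parity condition if: for each element $l$ with the other three elements $\{i,j,k\}$, $i=\min\{i,j,k\}$, call the rotation $(i,j,k)$ at $l$ positive if $j<k$ and negative if $k<j$; the number of negative rotations among the four is even. An abstract rotation system is good if every subsystem induced by a 4-element subset satisfies the parity condition. An abstract rotation system on $n$ elements is convex, $\mathcal{C}_n$, if its elements can be ordered $v_1,\dots,v_n$ so that the rotation at $v_i$ is $(v_1,\dots,v_{i-1},v_{i+1},\dots,v_n)$; it is twisted, $\mathcal{T}_n$, if they can be ordered so that the rotation at $v_i$ is $(v_{i-1},\dots,v_2,v_1,v_{i+1},v_{i+2},\dots,v_n)$. Two abstract rotation systems are isomorphic if they differ only by relabeling of the ground set; $\mathcal{R}$ contains $\mathcal{S}$ if some induced subsystem of $\mathcal{R}$ is isomorphic to $\mathcal{S}$.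
   Formalization: The conclusion allows a third alternative, the mirror image of T_{m2} (all rotations reversed), since with isomorphism by relabeling only, the mirror image of T_M is good but contains neither C_5 nor T_5. *)

(* Defs.v *)
From mathcomp Require Import all_boot all_order fingroup perm.

Set Implicit Arguments.
Unset Strict Implicit.
Unset Printing Implicit Defensive.

(* A cyclic permutation of V \ {v} is encoded as a permutation of V with V \ {v}
   as an orbit; it then fixes v (if V = {v}, the identity is the only choice). *)
Record rotation_system (V : finType) := RotationSystem {
  rotation :> V -> {perm V};
  rotation_cyclic : forall v x, x != v -> porbit (rotation v) x = [set~ v]
}.

Lemma next_inj (T : eqType) (s : seq T) : uniq s -> injective (next s).
Proof. by move=> us; exact: can_inj (prev_next us). Qed.

Lemma orbit_next (V : finType) (s : seq V) x : uniq s -> x \in s ->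
  orbit (next s) x =i s.
Proof.
by move=> us xs y; rewrite -fconnect_orbit (fconnect_cycle (cycle_next us) xs).
Qed.

Lemma porbit_fconnect (V : finType) (p : {perm V}) x y :
  (y \in porbit p x) = fconnect p x y.
Proof.
apply/porbitP/idP => [[i ->]|/iter_findex <-].
  by rewrite permX fconnect_iter.
by exists (findex p x y); rewrite permX.
Qed.

(* The cycle (s_1, ..., s_k), fixing all other elements. *)
Definition cycle_perm (V : finType) (s : seq V) : {perm V} :=
  perm (next_inj (undup_uniq s)).

Lemma cycle_permE (V : finType) (s : seq V) : uniq s ->
  cycle_perm s =1 next s.
Proof. by move=> us x; rewrite permE undup_id. Qed.

Lemma porbit_cycle_perm (V : finType) (s : seq V) x : uniq s -> x \in s ->
  porbit (cycle_perm s) x =i s.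
Proof.
move=> us xs y; rewrite porbit_fconnect (eq_fconnect (cycle_permE us)).
by rewrite fconnect_orbit orbit_next.
Qed.

Lemma cycle_perm_cyclic (V : finType) (c : V -> seq V)
    (cP : forall v, uniq (c v) /\ c v =i [set~ v]) v x :
  x != v -> porbit (cycle_perm (c v)) x = [set~ v].
Proof.
have [us cE] := cP v => xv; apply/setP => y.
by rewrite porbit_cycle_perm // cE // !inE.
Qed.

Definition rs_of_cycles (V : finType) (c : V -> seq V)
    (cP : forall v, uniq (c v) /\ c v =i [set~ v]) : rotation_system V :=
  RotationSystem (cycle_perm_cyclic cP).

Section Induced.
Variables (V : finType) (R : rotation_system V) (W : {set V}).
Implicit Types (w x y : {x : V | x \in W}) (p : {perm V}).

Definition trace p (z : V) : seq {x : V | x \in W} := pmap insub (orbit p z).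

(* From x, follow the cycle of p through x and stop at the next element of W. *)
Definition restrict_cycle p x : {x : V | x \in W} := next (trace p (val x)) x.

Lemma trace_uniq p z : uniq (trace p z).
Proof. by apply: pmap_sub_uniq; exact: orbit_uniq. Qed.

Lemma mem_trace p z y : (y \in trace p z) = fconnect p z (val y).
Proof. by rewrite mem_pmap_sub fconnect_orbit. Qed.

Lemma restrict_cycle_next p x y : fconnect p (val x) (val y) ->
  restrict_cycle p y = next (trace p (val x)) y.
Proof.
move=> xy; have yo : val y \in orbit p (val x) by rewrite -fconnect_orbit.
have [i oE] := orbit_rot_cycle (cycle_orbit (@perm_inj _ p) (val x))
  (orbit_uniq _ _) yo.
pose tk : seq {x : V | x \in W} := pmap insub (take i (orbit p (val x))).
have tE : trace p (val y) = rot (size tk) (trace p (val x)).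
  have -> : trace p (val x) = tk ++ pmap insub (drop i (orbit p (val x))).
    by rewrite -pmap_cat cat_take_drop.
  by rewrite rot_size_cat /trace oE pmap_cat.
by rewrite /restrict_cycle tE next_rot // trace_uniq.
Qed.

Lemma restrict_cycle_fconnect p x :
  fconnect p (val x) (val (restrict_cycle p x)).
Proof. by rewrite -mem_trace mem_next mem_trace. Qed.

Lemma restrict_cycle_inj p : injective (restrict_cycle p).
Proof.
move=> x y exy.
have xy : fconnect p (val x) (val y).
  apply: connect_trans (restrict_cycle_fconnect p x) _.
  by rewrite exy fconnect_sym ?restrict_cycle_fconnect //; exact: perm_inj.
move: exy; rewrite (restrict_cycle_next xy) /restrict_cycle.
by apply: next_inj; exact: trace_uniq.
Qed.

Definition restrict_perm p : {perm {x : V | x \in W}} :=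
  perm (@restrict_cycle_inj p).

Lemma restrict_perm_cyclic w x : x != w ->
  porbit (restrict_perm (R (val w))) x = [set~ w].
Proof.
move=> xw; apply/setP => y; rewrite !inE; set p := R (val w).
set c := trace p (val x).
have uc : uniq c by exact: trace_uniq.
have cE z : (z \in c) = (z != w).
  by rewrite mem_trace -porbit_fconnect rotation_cyclic ?inE.
have xc : x \in c by rewrite cE.
rewrite porbit_fconnect -cE -(orbit_next uc xc) -fconnect_orbit.
have itE i : iter i (restrict_perm p) x = iter i (next c) x /\
             iter i (next c) x \in c.
  elim: i => [|i [IH1 IH2]] //=; rewrite IH1 permE mem_next; split=> //.
  by rewrite (@restrict_cycle_next _ x) // -mem_trace.
apply/idP/idP => /iter_findex <-.
  by rewrite (itE _).1 fconnect_iter.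
by rewrite -(itE _).1 fconnect_iter.
Qed.

Definition induced : rotation_system {x : V | x \in W} :=
  RotationSystem restrict_perm_cyclic.

End Induced.

Definition isomorphic (V V' : finType)
    (R : rotation_system V) (S : rotation_system V') : Prop :=
  exists2 f : V -> V', bijective f & forall v x, f (R v x) = S (f v) (f x).

Definition contains (V V' : finType)
    (R : rotation_system V) (S : rotation_system V') : Prop :=
  exists W : {set V}, isomorphic (induced R W) S.

(* For #|V| = 4 and lt a strict linear order on V: the rotation at l is
   (i, j, k) with i the least element other than l, and k precedes j. *)
Definition negative (V : finType) (lt : rel V) (R : rotation_system V) (l : V) :=
  [exists i, [&& i != l, [forall x, (x != l) && (x != i) ==> lt i x]
               & lt (R l (R l i)) (R l i)]].

Definition parity_condition (V : finType) (lt : rel V)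
    (R : rotation_system V) : bool :=
  ~~ odd #|[set l | negative lt R l]|.

Definition good d (V : finOrderType d) (R : rotation_system V) : Prop :=
  forall W : {set V}, #|W| = 4 ->
    parity_condition (relpre val <%O) (induced R W).

Definition convex_cycle n (i : 'I_n) : seq 'I_n :=
  [seq j : 'I_n <- enum 'I_n | j < i] ++ [seq j : 'I_n <- enum 'I_n | i < j].

Definition twisted_cycle n (i : 'I_n) : seq 'I_n :=
  rev [seq j : 'I_n <- enum 'I_n | j < i] ++ [seq j : 'I_n <- enum 'I_n | i < j].

Lemma convex_cycleP n (i : 'I_n) :
  uniq (convex_cycle i) /\ convex_cycle i =i [set~ i].
Proof.
have fE (P : pred 'I_n) j : (j \in filter P (enum 'I_n)) = P j.
  by rewrite mem_filter mem_enum andbT.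
split=> [|j]; last by rewrite mem_cat !fE !inE -neq_ltn.
rewrite cat_uniq !filter_uniq -?enumT ?enum_uniq // andbT; apply/hasPn => j.
by rewrite !fE => /ltnW; rewrite leqNgt.
Qed.

Lemma twisted_cycleP n (i : 'I_n) :
  uniq (twisted_cycle i) /\ twisted_cycle i =i [set~ i].
Proof.
have [uc cE] := convex_cycleP i.
have eqp : perm_eq (twisted_cycle i) (convex_cycle i).
  by rewrite perm_cat2r perm_rev.
by split=> [|j]; rewrite ?(perm_uniq eqp) ?(perm_mem eqp) ?cE.
Qed.

Definition convex_rs n : rotation_system 'I_n := rs_of_cycles (@convex_cycleP n).

Definition twisted_rs n : rotation_system 'I_n := rs_of_cycles (@twisted_cycleP n).

Lemma mirror_cyclic (V : finType) (R : rotation_system V) v x :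
  x != v -> porbit (R v)^-1%g x = [set~ v].
Proof. by move=> xv; rewrite porbitV rotation_cyclic. Qed.

(* All rotations reversed. convex_rs n is isomorphic to its mirror image (reverse
   the order of the elements), but twisted_rs n is not when n >= 5. *)
Definition mirror (V : finType) (R : rotation_system V) : rotation_system V :=
  RotationSystem (@mirror_cyclic V R).

(* Main.v *)
(* By Ramsey's theorem for 4-subsets, a large system has a linearly ordered
   subset in which the orientation of i < j < k in the rotation at l depends
   only on the position of l among i, j, k: this leaves four signs s1, .., s4.
   The axioms of cyclic orders on five points force s1 = s2 and s3 = s4. The
   subset is then convex if s2 = s3 (after reversing the order if both signs are
   negative), and twisted or the mirror image of twisted otherwise. *)

Require Import Defs.
From mathcomp Require Import all_boot all_order fingroup perm zify.

Set Implicit Arguments.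
Unset Strict Implicit.
Unset Printing Implicit Defensive.

(** * Ramsey's theorem for sequences *)

Lemma pigeonhole_seq (T : eqType) (C : finType) (g : T -> C) n (s : seq T) :
  #|C| * n < size s -> exists c, n <= size [seq x <- s | g x == c].
Proof.
move=> ltns; apply/existsP; apply: contraLR ltns; rewrite negb_exists -leqNgt.
move=> /forallP small.
have -> : size s = \sum_(c : C) size [seq x <- s | g x == c].
  elim: s {small} => [|x s IHs] /=; first by rewrite big1.
  rewrite (bigD1 (g x)) //= eqxx /= addSn IHs [in LHS](bigD1 (g x)) //=.
  congr (_ + _).+1; apply: eq_bigr => c /negPf.
  by rewrite eq_sym => ->.
rewrite -sum_nat_const; apply: leq_sum => c _.
by apply: ltnW; rewrite ltnNge.
Qed.

(** A duplicate-free sequence stands for a linearly ordered set, and its subsequences of size [k]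
    for the [k]-subsets. *)
Definition homogeneous (T : eqType) (C : Type) (f : seq T -> C) k c t :=
  forall u, subseq u t -> size u = k -> f u = c.

Definition end_homogeneous (T : eqType) (C : Type) (f : seq T -> C) k
    (g : T -> C) t :=
  forall x u, subseq (x :: u) t -> size u = k -> f (x :: u) = g x.

(** Induction on [k]: the sequence is thinned until the colour of a [k.+1]-subsequence depends only
    on its first element, and the pigeonhole principle then makes that colour constant. *)
Lemma ramsey_seq (C : finType) k n : exists N,
  forall (T : eqType) (f : seq T -> C) (s : seq T), uniq s -> N <= size s ->
  exists c t, [/\ subseq t s, size t = n & homogeneous f k c t].
Proof.
elim: k n => [|k IHk] n.
  exists n => T f s us ns; exists (f [::]), (take n s).
  by split=> [||[]//]; [exact: take_subseq | exact: size_takel].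
(* The length [(#|C| * n).+1] lets the pigeonhole principle leave [n] elements with equal values of
   [g]. *)
have [N NP] : exists N, forall (T : eqType) (f : seq T -> C) (s : seq T),
    uniq s -> N <= size s -> exists g t,
    [/\ subseq t s, size t = (#|C| * n).+1 & end_homogeneous f k g t].
  (* Induction on the length: the head [x] is kept, and the tail is thinned so that [f (x :: u)] is
     constant and then treated recursively. *)
  elim: (_.+1) => [|m [Nm NmP]].
    have [N0 N0P] := IHk 0; exists N0 => T f s us ns.
    have [c _] := N0P T f s us ns.
    by exists (fun=> c), [::]; split=> //; exact: sub0seq.
  have [N NP] := IHk Nm; exists N.+1 => T f [|x s] //= /andP[xs us] ns.
  have [c [t [ts st ht]]] := NP T (fun u => f (x :: u)) s us ns.
  have ut : uniq t by exact: subseq_uniq ts us.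
  have [|g [v [vt sv hv]]] := NmP T f t ut; first by rewrite st.
  have xv : x \notin v.
    by apply: contra xs => /(mem_subseq vt)/(mem_subseq ts).
  exists (fun y => if y == x then c else g y), (x :: v); split.
  - by rewrite /= eqxx (subseq_trans vt).
  - by rewrite /= sv.
  - move=> y u /=; case: (eqVneq y x) => [-> uv su|yx yuv su].
      by apply: ht => //; exact: subseq_trans vt.
    exact: hv.
exists N => T f s us ns; have [g [t [ts st ht]]] := NP T f s us ns.
have [c cP] := @pigeonhole_seq _ _ g n t (eq_leq (esym st)).
exists c, (take n [seq x <- t | g x == c]); split.
- apply: subseq_trans (take_subseq _ _) _.
  exact: subseq_trans (filter_subseq _ _) ts.
- exact: size_takel.
- move=> [|x u] // xuS [su].
  have xuF := subseq_trans xuS (take_subseq _ _).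
  rewrite (ht _ _ (subseq_trans xuF (filter_subseq _ _)) su).
  have := mem_subseq xuF (mem_head x u).
  by rewrite mem_filter => /andP[/eqP].
Qed.

(** An increasing list of indices is a filter of [iota], and reading all of [t] along [iota] gives
    back [t]. *)
Lemma subseq_map_nth (T : eqType) (x0 : T) (t : seq T) (u : seq nat) :
  sorted ltn u -> all (gtn (size t)) u ->
  subseq [seq nth x0 t i | i <- u] t.
Proof.
move=> su /allP au.
have -> : u = [seq i <- iota 0 (size t) | i \in u].
  apply: (irr_sorted_eq ltn_trans ltnn) => //.
    by apply: sorted_filter (iota_ltn_sorted _ _); exact: ltn_trans.
  move=> i; rewrite mem_filter mem_iota add0n /=.
  by case iu: (i \in u) => //=; have /= -> := au i iu.
rewrite -[X in subseq _ X](mkseq_nth x0).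
by apply: map_subseq; exact: filter_subseq.
Qed.

(** * Cyclic orders along the cycles of a permutation *)

Lemma sorted_findex (T : finType) (p : T -> T) x :
  sorted (fun y z => findex p x y < findex p x z) (orbit p x).
Proof.
apply/(sortedP x) => i; rewrite size_orbit => ltio.
by rewrite !nth_traject ?(ltnW ltio) // !findex_iter // ltnW.
Qed.

(* For distinct x, y, z in one cycle of p: from x, the cycle meets y before z. *)
Definition ccw (T : finType) (p : T -> T) x y z := findex p x y < findex p x z.

(** Distances along a cycle are differences of positions modulo its length; in the second branch the
    walk from [x] to [y] wraps around through [b]. *)
Lemma findex_rebase (T : finType) (p : {perm T}) b x y :
  fconnect p b x -> fconnect p b y ->
  findex p x y = (if findex p b x <= findex p b y then findex p b y
                  else findex p b y + fingraph.order p b) - findex p b x.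
Proof.
move=> bx by_.
have ox : fingraph.order p x = fingraph.order p b.
  rewrite /fingraph.order; apply: eq_card => z; rewrite !inE.
  by rewrite (same_connect (fconnect_sym (@perm_inj _ p)) bx).
have := findex_max bx; have := findex_max by_.
set k := fingraph.order p b => ltyk ltxk.
have E n : n < k -> iter (findex p b x + n) p b = y -> findex p x y = n.
  move=> ltnk <-; rewrite addnC iterD (iter_findex bx) findex_iter //.
  by rewrite ox.
case: leqP => le; apply: E.
- lia.
- by rewrite subnKC // iter_findex.
- lia.
- rewrite subnKC; last by lia.
  by rewrite iterD iter_order ?iter_findex //; exact: perm_inj.
Qed.

Definition ccw_nat i j k := [|| i < j < k, j < k < i | k < i < j].

(** Turns identities between cyclic orders into linear arithmetic on positions counted from one base
    point. *)
Lemma ccw_rebase (T : finType) (p : {perm T}) b x y z :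
  fconnect p b x -> fconnect p b y -> fconnect p b z ->
  x != y -> x != z -> y != z ->
  ccw p x y z = ccw_nat (findex p b x) (findex p b y) (findex p b z).
Proof.
move=> bx by_ bz xy xz yz; rewrite /ccw /ccw_nat.
rewrite (findex_rebase bx by_) (findex_rebase bx bz).
have inj u v : fconnect p b u -> fconnect p b v -> u != v ->
    findex p b u != findex p b v.
  move=> bu bv; apply: contraNneq => e.
  by rewrite -(iter_findex bu) e iter_findex.
have := inj _ _ bx by_ xy; have := inj _ _ bx bz xz; have := inj _ _ by_ bz yz.
have := findex_max bx; have := findex_max by_; have := findex_max bz.
case: (leqP (findex p b x) (findex p b y));
  case: (leqP (findex p b x) (findex p b z)); lia.
Qed.

Section RotationSystemTheory.
Variables (V : finType) (R : rotation_system V).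
Implicit Types v x y z : V.

Lemma rotation_fconnect v x y : x != v -> fconnect (R v) x y = (y != v).
Proof. by move=> xv; rewrite -porbit_fconnect rotation_cyclic // !inE. Qed.

Lemma rotation_fix v : R v v = v.
Proof.
apply/eqP/negPn/negP => Rv; have := rotation_fconnect v Rv.
rewrite eqxx fconnect_sym; last exact: perm_inj.
by rewrite fconnect1.
Qed.

Lemma ccw_rot v x y z : x != v -> y != v -> z != v ->
  x != y -> x != z -> y != z -> ccw (R v) y z x = ccw (R v) x y z.
Proof.
move=> xv yv zv xy xz yz.
have c u : u != v -> fconnect (R v) x u by rewrite rotation_fconnect.
rewrite !(@ccw_rebase _ _ x) ?c // 1?eq_sym // /ccw_nat; lia.
Qed.

Lemma ccw_swap v x y z : x != v -> y != v -> z != v ->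
  x != y -> x != z -> y != z -> ccw (R v) x z y = ~~ ccw (R v) x y z.
Proof.
move=> xv yv zv xy xz yz; rewrite /ccw ltn_neqAle -leqNgt.
case: eqP => //= e; case/eqP: yz.
have c u : u != v -> fconnect (R v) x u by rewrite rotation_fconnect.
by rewrite -(iter_findex (c y yv)) -e iter_findex ?c.
Qed.

Lemma ccw_rev v x y z : x != v -> y != v -> z != v ->
  x != y -> x != z -> y != z -> ccw (R v) z y x = ~~ ccw (R v) x y z.
Proof.
move=> xv yv zv xy xz yz; have zy : z != y by rewrite eq_sym.
by rewrite (ccw_rot xv zv yv xz xy zy) (ccw_swap xv yv zv xy xz yz).
Qed.

(** Cut open at [x], the cycle is a linear order: if both signs are true, it runs through [y], [z],
    [w], and if both are false, through [w], [z], [y]. The equational form covers both orientations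
    at once. *)
Lemma ccw_trans v x y z w : all [pred u | u != v] [:: x; y; z; w] ->
  uniq [:: x; y; z; w] -> ccw (R v) x y z = ccw (R v) x z w ->
  ccw (R v) y z w = ccw (R v) x z w.
Proof.
rewrite /= !inE !negb_or.
move=> /and5P[xv yv zv wv _] /and4P[/and3P[xy xz xw] /andP[yz yw] zw _].
have c u : u != v -> fconnect (R v) x u by rewrite rotation_fconnect.
have := ccw_swap xv yv zv xy xz yz; have := ccw_swap xv zv wv xz xw zw.
have x_min u : u != x -> findex (R v) x u != 0 by rewrite findex_eq0 eq_sym.
rewrite (@ccw_rebase _ _ x y z w) ?c // /ccw /ccw_nat; lia.
Qed.

End RotationSystemTheory.

(** * Recognizing a system inside a larger one *)

(** The triples that begin with the head of [c i] say that positions counted from the image of the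
    head increase along [c i]. Hence the trace of the rotation on the image of [h] is the image of
    [c i], and both have the same successors. *)
Lemma contains_of_cycles (V : finType) (R : rotation_system V) m (h : 'I_m -> V)
    (S : rotation_system 'I_m) (c : 'I_m -> seq 'I_m) (r : 'I_m -> rel 'I_m) :
  injective h ->
  (forall i, c i =i [set~ i]) -> (forall i, S i =1 next (c i)) ->
  (forall i, uniq (c i)) -> (forall i, pairwise (r i) (c i)) ->
  (forall i (x y z : 'I_m), x != i -> y != i -> z != i ->
     r i x y -> r i x z -> r i y z -> ccw (R (h i)) (h x) (h y) (h z)) ->
  contains R S.
Proof.
move=> h_inj cE SE uc rc rccw; pose W := [set h i | i : 'I_m]; exists W.
have hW i : h i \in W by exact: imset_f.
pose g i : {x : V | x \in W} := Sub (h i) (hW i).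
have g_inj : injective g by move=> i j /(congr1 val) /h_inj.
have g_bij : bijective g.
  apply: inj_card_bij => //; rewrite card_sig -(card_imset _ h_inj).
  by apply/subset_leq_card/subsetP => y.
have [f gK fK] := g_bij.
exists f; first by exists g.
move=> v x; rewrite -(fK v) -(fK x) !gK; move: (f v) (f x) => i j {v x}.
rewrite -[RHS]gK; congr f.
have [->|ji] := eqVneq j i; first by rewrite !rotation_fix.
apply: val_inj; rewrite permE SE /=; set p := R (h i).
case ci: (c i) (cE i) (uc i) (rc i) => [|k s] ciE us /=.
  by have := ciE j; rewrite !inE ji.
have ki : k != i by have := ciE k; rewrite !inE eqxx => <-.
have hki l : l != i -> h l != h i by rewrite (inj_eq h_inj).
case/andP=> /allP rk rs.
have ccw_s : {in s &, forall y z,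
    r i y z -> findex p (h k) (h y) < findex p (h k) (h z)}.
  move=> y z ys zs; have := ciE y; have := ciE z.
  rewrite !inE ys zs !orbT => /esym zi /esym yi.
  by apply: rccw => //; exact: rk.
(* Both sequences are sorted by the position counted from [h k] and have the same elements. *)
have trE : trace W p (h k) = [seq g l | l <- k :: s].
  pose lt (y z : {x : V | x \in W}) :=
    findex p (h k) (val y) < findex p (h k) (val z).
  apply: (@irr_sorted_eq _ lt).
  - by move=> y x z; exact: ltn_trans.
  - by move=> x; exact: ltnn.
  - suff : sorted (fun y z => findex p (h k) y < findex p (h k) z)
        (map val (trace W p (h k))) by rewrite sorted_map.
    rewrite /trace pmap_filter; last exact: insubK.
    apply: sorted_filter (sorted_findex _ _).
    by move=> y x z; exact: ltn_trans.
  - rewrite sorted_map; apply: pairwise_sorted => /=; apply/andP; split.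
      apply/allP => y ys; rewrite /lt /= findex0 lt0n findex_eq0.
      by apply: contraTneq us => /h_inj ->; rewrite /= ys.
    by apply: (sub_in_pairwise (P := mem s)) rs.
  - move=> y; rewrite mem_trace rotation_fconnect ?hki //.
    rewrite -(fK y) mem_map // ciE !inE /=.
    by rewrite (inj_eq h_inj).
(* The successor of [g j] may be read off in the trace from [g k], since both lie on the same
   cycle. *)
rewrite (@restrict_cycle_next _ _ _ (g k)) /=; last first.
  by rewrite rotation_fconnect ?hki.
by rewrite trE next_map.
Qed.

(** * The orders in which the convex and twisted cycles list their elements *)

Lemma pairwise_rev (T : Type) (r : rel T) s :
  pairwise r (rev s) = pairwise (fun x y => r y x) s.
Proof.
by elim: s => //= x s IHs; rewrite rev_cons pairwise_rcons all_rev IHs.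
Qed.

Lemma pairwise_enum_ord n (P : pred 'I_n) :
  pairwise (fun i j : 'I_n => i < j) [seq i <- enum 'I_n | P i].
Proof.
apply: pairwise_filter.
rewrite -(pairwise_map val ltn) val_enum_ord -sorted_pairwise.
  exact: iota_ltn_sorted.
exact: ltn_trans.
Qed.

Lemma convex_cycle_pairwise n (i : 'I_n) :
  pairwise (fun x y : 'I_n => x < y) (convex_cycle i).
Proof.
rewrite pairwise_cat !pairwise_enum_ord !andbT; apply/allrelP => x y.
by rewrite !mem_filter => /andP[xi _] /andP[iy _]; exact: ltn_trans iy.
Qed.

Definition before_twisted n (i x y : 'I_n) :=
  if x < i then (y < x) || (i < y) else x < y.

Lemma before_twisted_neq n (i x y : 'I_n) : before_twisted i x y -> x != y.
Proof.
by apply: contraTneq => ->; rewrite /before_twisted ltnn; case: ltngtP.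
Qed.

(** Provides what [sign_pattern] asks for: the order of the triple by size, and the side of [i] on
    which its middle element lies. *)
Lemma before_twisted_cases n (i x y z : 'I_n) : x != i -> y != i ->
  before_twisted i x y -> before_twisted i x z -> before_twisted i y z ->
  [\/ i < y /\ x < y < z, y < i /\ z < y < x | x < i /\ y < x < z].
Proof.
rewrite /before_twisted -!val_eqE /= => xi yi.
case: (ltnP x i) => ltxi; case: (ltnP y i) => ltyi /= xy xz yz.
- case: (ltnP z i) => ltzi; [constructor 2 | constructor 3]; lia.
- constructor 1; lia.
- lia.
- constructor 1; lia.
Qed.

Lemma twisted_cycle_pairwise n (i : 'I_n) :
  pairwise (before_twisted i) (twisted_cycle i).
Proof.
rewrite pairwise_cat; apply/and3P; split.
- apply/allrelP => x y; rewrite mem_rev !mem_filter => /andP[xi _] /andP[iy _].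
  by rewrite /before_twisted xi iy orbT.
- rewrite pairwise_rev.
  apply: (sub_in_pairwise (P := fun x : 'I_n => x < i)) (pairwise_enum_ord _).
    move=> x y; rewrite !unfold_in /before_twisted => _ yi xy.
    by rewrite yi xy.
  exact: filter_all.
- apply: (sub_in_pairwise (P := fun x : 'I_n => i < x)) (pairwise_enum_ord _).
    move=> x y; rewrite !unfold_in /before_twisted => ix _ xy.
    by rewrite ltnNge ltnW.
  exact: filter_all.
Qed.

(** * Sign patterns and the systems they determine *)

Section Homogeneous.
Variables (V : finType) (R : rotation_system V).

(** Comparing [l] with the middle element [j] alone builds in [s1 = s2], their common value being
    [a], and [s3 = s4], their common value being [b]. *)
Definition sign_pattern m (h : 'I_m -> V) (a b : bool) :=
  forall l i j k : 'I_m, i != l -> j != l -> k != l -> i < j < k ->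
  ccw (R (h l)) (h i) (h j) (h k) = if l < j then a else b.

Variables (m : nat) (h : 'I_m -> V).
Hypothesis h_inj : injective h.

(** Reversal makes increasing triples decreasing, which negates the signs, and swaps the two sides
    of the middle element, which exchanges them. *)
Lemma sign_pattern_rev a b : sign_pattern h a b ->
  sign_pattern (h \o @rev_ord m) (~~ b) (~~ a).
Proof.
move=> hab l i j k il jl kl ijk /=.
have E (x y : 'I_m) : x != y -> h (rev_ord x) != h (rev_ord y).
  by rewrite (inj_eq h_inj) (inj_eq rev_ord_inj).
have [ij ik jk] : [/\ i != j, i != k & j != k].
  by rewrite -!(inj_eq val_inj) /=; split; lia.
have -> : ccw (R (h (rev_ord l)))
      (h (rev_ord i)) (h (rev_ord j)) (h (rev_ord k)) =
    ~~ ccw (R (h (rev_ord l)))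
      (h (rev_ord k)) (h (rev_ord j)) (h (rev_ord i)).
  by rewrite ccw_rev ?E // eq_sym.
have := ltn_ord l; have := ltn_ord k => km lm.
rewrite hab ?(inj_eq rev_ord_inj) //=; last by lia.
by rewrite -val_eqE /= in jl; case: (ltnP l j) => lj; case: ltnP => //; lia.
Qed.

Lemma contains_convex : sign_pattern h true true -> contains R (convex_rs m).
Proof.
move=> hP; apply: (contains_of_cycles h_inj (c := @convex_cycle m)
  (r := fun _ x y => x < y)) => i.
- exact: (convex_cycleP i).2.
- by move=> x; rewrite cycle_permE //; exact: (convex_cycleP i).1.
- exact: (convex_cycleP i).1.
- exact: convex_cycle_pairwise.
- by move=> x y z xi yi zi xy _ yz; rewrite hP ?if_same // xy.
Qed.

(** If the middle element by size is above [i], the triple is increasing and has sign [~~ b]. If it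
    is below [i], the increasing triple has sign [b], but the twisted order is an odd permutation of
    it. *)
Lemma ccw_before_twisted b (i x y z : 'I_m) : sign_pattern h (~~ b) b ->
  x != i -> y != i -> z != i ->
  before_twisted i x y -> before_twisted i x z -> before_twisted i y z ->
  ccw (R (h i)) (h x) (h y) (h z) = ~~ b.
Proof.
move=> hP xi yi zi xy xz yz.
have xNy := before_twisted_neq xy.
have xNz := before_twisted_neq xz.
have yNz := before_twisted_neq yz.
have E (u v : 'I_m) : u != v -> h u != h v by rewrite (inj_eq h_inj).
have rev_xyz : ccw (R (h i)) (h x) (h y) (h z) =
    ~~ ccw (R (h i)) (h z) (h y) (h x).
  by rewrite (ccw_rev R (E _ _ xi) (E _ _ yi) (E _ _ zi)) ?E ?negbK.
have swap_xyz : ccw (R (h i)) (h x) (h y) (h z) =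
    ~~ ccw (R (h i)) (h y) (h x) (h z).
  have yNx : y != x by rewrite eq_sym.
  rewrite -(ccw_rev R (E _ _ yi) (E _ _ xi) (E _ _ zi)) ?E //.
  by rewrite -(ccw_rot R (E _ _ zi) (E _ _ xi) (E _ _ yi)) // E // eq_sym.
have [[lt_iy xyz]|[lt_yi zyx]|[lt_xi yxz]] :=
  before_twisted_cases xi yi xy xz yz.
- by rewrite hP // lt_iy.
- by rewrite rev_xyz hP // ltnNge ltnW.
- by rewrite swap_xyz hP // ltnNge ltnW.
Qed.

Lemma contains_twisted :
  sign_pattern h true false -> contains R (twisted_rs m).
Proof.
move=> hP; apply: (contains_of_cycles h_inj (c := @twisted_cycle m)
  (r := @before_twisted m)) => i.
- exact: (twisted_cycleP i).2.
- by move=> x; rewrite cycle_permE //; exact: (twisted_cycleP i).1.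
- exact: (twisted_cycleP i).1.
- exact: twisted_cycle_pairwise.
- by move=> *; rewrite (@ccw_before_twisted false).
Qed.

(** Reversing the indices maps the pair [false true] to itself, so it does not lead to [true false].
    The pattern is matched with the inverse rotations instead, whose cycles are the reversed
    lists. *)
Lemma contains_mirror_twisted :
  sign_pattern h false true -> contains R (mirror (twisted_rs m)).
Proof.
move=> hP; apply: (contains_of_cycles h_inj
  (c := fun i => rev (twisted_cycle i))
  (r := fun i x y => before_twisted i y x)) => i.
- by move=> x; rewrite mem_rev (twisted_cycleP i).2.
- have uc := (twisted_cycleP i).1; move=> x; rewrite next_rev //.
  apply: (@perm_inj _ (twisted_rs m i)).
  by rewrite permKV cycle_permE // next_prev.
- by rewrite rev_uniq; exact: (twisted_cycleP i).1.
- by rewrite pairwise_rev; exact: twisted_cycle_pairwise.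
- move=> x y z xi yi zi yx zx zy.
  have E (u v : 'I_m) : u != v -> h u != h v by rewrite (inj_eq h_inj).
  have yNx := before_twisted_neq yx.
  have zNx := before_twisted_neq zx.
  have zNy := before_twisted_neq zy.
  rewrite (ccw_rev R (E _ _ zi) (E _ _ yi) (E _ _ xi)) ?E //.
  by rewrite (ccw_before_twisted hP zi yi xi zy zx yx).
Qed.

End Homogeneous.

(** * Ramsey's theorem applied to rotation systems *)

Lemma ramsey_sign_pattern n : exists N,
  forall (V : finType) (R : rotation_system V), N <= #|V| ->
  exists a b (h : 'I_n -> V), injective h /\ sign_pattern R h a b.
Proof.
(* The summand 5 provides the five points that relate the signs, also when [n] is small. *)
have [N NP] := ramsey_seq (bool * bool * bool * bool)%type 4 (n + 5).
exists N => V R; rewrite cardE => leN.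
pose f (u : seq V) := if u is [:: x; y; z; w] then
  (ccw (R x) y z w, ccw (R y) x z w, ccw (R z) x y w, ccw (R w) x y z)
  else (true, true, true, true).
have [[[[s1 s2] s3] s4] [t [ts st ht]]] := NP V f (enum V) (enum_uniq V) leN.
have ut : uniq t by exact: subseq_uniq ts (enum_uniq V).
have [x0 _] : exists x0, x0 \in t.
  case: t st {ts ht ut} => [|x t]; first by rewrite addnC.
  by exists x; exact: mem_head.
pose g i := nth x0 t i.
have g_inj i j : i < n + 5 -> j < n + 5 -> (g i == g j) = (i == j).
  by move=> lti ltj; rewrite nth_uniq ?st.
have col i j k l : i < j -> j < k -> k < l -> l < n + 5 ->
    [/\ ccw (R (g i)) (g j) (g k) (g l) = s1,
        ccw (R (g j)) (g i) (g k) (g l) = s2,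
        ccw (R (g k)) (g i) (g j) (g l) = s3 &
        ccw (R (g l)) (g i) (g j) (g k) = s4].
  move=> ij jk kl ln; have := ht (map g [:: i; j; k; l]) _ erefl.
  rewrite subseq_map_nth /= ?ij ?jk ?kl // ?st; last by lia.
  by move=> /(_ isT) [-> -> -> ->].
have lt5 i : i < 5 -> i < n + 5 by move=> lti; rewrite ltn_addl.
have g5_inj : {in gtn 5 &, injective g}.
  by move=> i j /lt5 lti /lt5 ltj /eqP; rewrite g_inj // => /eqP.
have g_neq i j : i < 5 -> j < 5 -> i != j -> g i != g j.
  by move=> lti ltj; apply: contra_neq; exact: g5_inj.
have g_uniq s : all (gtn 5) s -> uniq s -> uniq (map g s).
  move=> /allP s5 us; rewrite map_inj_in_uniq // => i j /s5 i5 /s5 j5.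
  exact: g5_inj.
(* In the rotation at point 1, the triples 023 and 034 have sign [s2] and 234 has sign [s1];
   transitivity seen from 0 equates them. *)
have s21 : s2 = s1.
  have [_ e023 _ _] := @col 0 1 2 3 isT isT isT (lt5 3 isT).
  have [_ e034 _ _] := @col 0 1 3 4 isT isT isT (lt5 4 isT).
  have [e234 _ _ _] := @col 1 2 3 4 isT isT isT (lt5 4 isT).
  rewrite -e234 -e034; apply/esym/ccw_trans; last by rewrite e023 e034.
    by rewrite /= !g_neq.
  exact: (g_uniq [:: 0; 2; 3; 4]).
(* In the rotation at point 3, the triples 014 and 124 have sign [s3] and 012 has sign [s4]. Rotated
   to 401 and 412, the first two give the third by transitivity seen from 4. *)
have s34 : s3 = s4.
  have [_ _ _ e012] := @col 0 1 2 3 isT isT isT (lt5 3 isT).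
  have [_ _ e014 _] := @col 0 1 3 4 isT isT isT (lt5 4 isT).
  have [_ _ e124 _] := @col 1 2 3 4 isT isT isT (lt5 4 isT).
  have r014 : ccw (R (g 3)) (g 4) (g 0) (g 1) = s3.
    by rewrite -e014; apply/esym/ccw_rot; exact: g_neq.
  have r124 : ccw (R (g 3)) (g 4) (g 1) (g 2) = s3.
    by rewrite -e124; apply/esym/ccw_rot; exact: g_neq.
  rewrite -e012 -r124; apply/esym/ccw_trans; last by rewrite r014 r124.
    by rewrite /= !g_neq.
  exact: (g_uniq [:: 4; 0; 1; 2]).
exists s1, s4, (fun i => g i); split.
  move=> i j /eqP; rewrite g_inj ?(ltn_addr _ (ltn_ord _)) //.
  by move=> /eqP/val_inj.
move=> l i j k il jl kl /andP[ij jk].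
have lt (x : 'I_n) : x < n + 5 by rewrite ltn_addr.
rewrite -val_eqE /= in il jl kl.
case: (ltnP l j) => lj.
  case: (ltnP l i) => li; first by have [->] := col l i j k li ij jk (lt k).
  have {}il : i < l by rewrite ltn_neqAle il.
  by have [_ -> _ _] := col i l j k il lj jk (lt k).
have {}jl : j < l by rewrite ltn_neqAle jl.
case: (ltnP l k) => lk.
  by have [_ _ -> _] := col i j l k ij jl lk (lt k).
have {}kl : k < l by rewrite ltn_neqAle kl.
by have [_ _ _ ->] := col i j k l ij jk kl (lt l).
Qed.

Theorem theorem10 (m1 m2 : nat) (hm1 : 0 < m1) (hm2 : 0 < m2) :
  exists M : nat,
    forall (d : Order.disp_t) (V : finOrderType d) (R : rotation_system V),
      #|V| = M -> good R ->
      [\/ contains R (convex_rs m1), contains R (twisted_rs m2)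
        | contains R (mirror (twisted_rs m2))].
Proof.
(* Of the [m1 + m2] points, the first [m1] serve the convex outcomes and the last [m2] the twisted
   ones; both index embeddings preserve the order. *)
have [N NP] := ramsey_sign_pattern (m1 + m2).
exists N => d V R cV _.
have [a [b [h [h_inj hP]]]] := NP V R (eq_leq (esym cV)).
have h1_inj := inj_comp h_inj (@lshift_inj m1 m2).
have hP1 : sign_pattern R (h \o @lshift m1 m2) a b.
  by move=> l i j k il jl kl ijk; rewrite /= hP // (inj_eq (@lshift_inj _ _)).
have h2_inj := inj_comp h_inj (@rshift_inj m1 m2).
have hP2 : sign_pattern R (h \o @rshift m1 m2) a b.
  move=> l i j k il jl kl ijk /=.
  by rewrite hP ?(inj_eq (@rshift_inj _ _)) //= !ltn_add2l.
case: a b {hP} hP1 hP2 => [] [] hP1 hP2.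
- by constructor 1; exact: contains_convex hP1.
- constructor 2; exact: contains_twisted hP2.
- constructor 3; exact: contains_mirror_twisted hP2.
- constructor 1.
  apply: (contains_convex (h := h \o @lshift m1 m2 \o @rev_ord m1)).
    exact: inj_comp h1_inj (@rev_ord_inj m1).
  exact: sign_pattern_rev hP1.
Qed.
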